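(* Let $k$ be a field, let $n\ge 1$ and $d\ge 1$ be integers, and let $f:\mathbf{P}^n_k \dashrightarrow \mathbf{P}^n_k$ be a dominant rational map whose components $f_0,\dots,f_n$ are monomials of degree $d$ in the homogeneous coordinates $x_0,\dots,x_n$, with no common factors. If the degree $\deg(f)$ of $f$ (as a map) is not divisible by $d$, then the dimension of the indeterminacy locus of $f$ is at least $(n-2)/2$.
   Context: $\mathbf{P}^n_k$ is the $n$-dimensional projective space over $k$, with homogeneous coordinates $x_0,\dots,x_n$. A map ''defined by monomials of degree $d$ with no common factors'' is $x\mapsto (f_0(x):\dots:f_n(x))$, where each $f_i=x_0^{a_{i0}}\cdots x_n^{a_{in}}$ is a monomial (with coefficient 1, $a_{ij}\in\mathbf{Z}_{\ge 0}$) with $\sum_{j} a_{ij}=d$ for every $i$, and no variable $x_j$ divides all of $f_0,\dots,f_n$ (that is, for each $j$ there is an $i$ with $a_{ij}=0$). The degree $\deg(f)$ of the dominant rational map $f$ is the degree of the associated extension of function fields. The indeterminacy locus of $f$ is the closed subscheme of $\mathbf{P}^n_k$ defined by the equations $f_0=\dots=f_n=0$. *)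

(* Defs.v *)
From HB Require Import structures.
From mathcomp Require Import all_boot all_order all_algebra.
From mathcomp Require Import ring_quotient fraction.
From mathcomp.multinomials Require Import mpoly.

Set Implicit Arguments.
Unset Strict Implicit.
Unset Printing Implicit Defensive.

Import Order.TTheory GRing.Theory Num.Theory.
Local Open Scope ring_scope.

(* P^n_k is the underlying topological space of Proj k[x_0, ..., x_n]: its
   points are the homogeneous prime ideals that do not contain the irrelevant
   ideal (x_0, ..., x_n). *)
Record proj_point (k : fieldType) (n : nat) := ProjPoint {
  pt_ideal :> {pred {mpoly k[n.+1]}};
  pt_idealr : idealr_closed pt_ideal;
  pt_prime : prime_idealr_closed pt_ideal;
  pt_homog : forall (e : nat) (u : {mpoly k[n.+1]}),
    u \in pt_ideal -> pihomog mdeg e u \in pt_ideal;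
  pt_relevant : exists j : 'I_n.+1, 'X_j \notin pt_ideal
}.

Definition proj_set (k : fieldType) (n : nat) := proj_point k n -> Prop.

Definition proj_sub (k : fieldType) (n : nat) (A B : proj_set k n) : Prop :=
  forall P, A P -> B P.

Definition zero_locus (k : fieldType) (n : nat)
    (S : {mpoly k[n.+1]} -> Prop) : proj_set k n :=
  fun P => forall u, S u -> u \in pt_ideal P.

Definition zariski_closed (k : fieldType) (n : nat) (C : proj_set k n) : Prop :=
  exists S : {mpoly k[n.+1]} -> Prop,
    (forall u, S u -> u \is homog mdeg) /\
    (forall P, C P <-> zero_locus S P).

Definition irreducible_closed (k : fieldType) (n : nat)
    (C : proj_set k n) : Prop :=
  [/\ zariski_closed C,
      exists P, C P
    & forall A B : proj_set k n, zariski_closed A -> zariski_closed B ->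
        (forall P, C P -> A P \/ B P) -> proj_sub C A \/ proj_sub C B].

(* Z_0 < Z_1 < ... < Z_r, with strict inclusions. For W closed, the closed
   irreducible subsets of the space W are those of P^n contained in W. *)
Definition irreducible_chain (k : fieldType) (n : nat) (W : proj_set k n)
    (r : nat) (Z : nat -> proj_set k n) : Prop :=
  (forall i, (i <= r)%N -> irreducible_closed (Z i) /\ proj_sub (Z i) W) /\
  (forall i, (i < r)%N ->
     proj_sub (Z i) (Z i.+1) /\ ~ proj_sub (Z i.+1) (Z i)).

(* q <= dim W, where dim W is the supremum of the lengths r of the chains of
   irreducible closed subsets of W, and the empty set has dimension -oo. *)
Definition dim_at_least (k : fieldType) (n : nat) (W : proj_set k n)
    (q : rat) : Prop :=
  exists (r : nat) (Z : nat -> proj_set k n),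
    irreducible_chain W r Z /\ q <= r%:R.

(* Below, f = (f_0 : ... : f_n) is given by its components, homogeneous of the
   same degree d > 0. *)

Definition indeterminacy_locus (k : fieldType) (n : nat)
    (f : (n.+1).-tuple {mpoly k[n.+1]}) : proj_set k n :=
  zero_locus (fun u => u \in f).

(* For P outside the indeterminacy locus, f(P) is the contraction of the prime
   P along the morphism x_i |-> f_i. *)
Definition maps_to (k : fieldType) (n : nat)
    (f : (n.+1).-tuple {mpoly k[n.+1]}) (P Q : proj_point k n) : Prop :=
  ~ indeterminacy_locus f P /\
  (forall u, (u \in pt_ideal Q) = (u \mPo f \in pt_ideal P)).

Definition dominant (k : fieldType) (n : nat)
    (f : (n.+1).-tuple {mpoly k[n.+1]}) : Prop :=
  forall C : proj_set k n, zariski_closed C ->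
    (forall P Q, maps_to f P Q -> C Q) -> forall Q, C Q.

(* The function field of P^n_k, inside Frac(k[x_0, ..., x_n]). *)
Definition function_field (k : fieldType) (n : nat)
    (z : {fraction {mpoly k[n.+1]}}) : Prop :=
  exists (e : nat) (u v : {mpoly k[n.+1]}),
    [/\ u \is e.-homog, v \is e.-homog, v != 0
      & z = tofrac u / tofrac v].

(* The image of f^* : k(P^n) -> k(P^n), u / v |-> u(f) / v(f). When f is
   dominant, v(f) != 0 as soon as v != 0. *)
Definition pullback_field (k : fieldType) (n : nat)
    (f : (n.+1).-tuple {mpoly k[n.+1]})
    (z : {fraction {mpoly k[n.+1]}}) : Prop :=
  exists (e : nat) (u v : {mpoly k[n.+1]}),
    [/\ u \is e.-homog, v \is e.-homog, v != 0
      & z = tofrac (u \mPo f) / tofrac (v \mPo f)].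

(* [L : K] = m, for subfields K of L of a field F: L has a K-basis of m
   elements. *)
Definition extension_degree (F : fieldType) (K L : F -> Prop) (m : nat) : Prop :=
  exists b : 'I_m -> F,
    [/\ forall i, L (b i),
        forall z, L z -> exists c : 'I_m -> F,
          (forall i, K (c i)) /\ z = \sum_(i < m) c i * b i
      & forall c : 'I_m -> F, (forall i, K (c i)) ->
          \sum_(i < m) c i * b i = 0 -> forall i, c i = 0].

Definition map_degree (k : fieldType) (n : nat)
    (f : (n.+1).-tuple {mpoly k[n.+1]}) (m : nat) : Prop :=
  extension_degree (pullback_field f) (@function_field k n) m.

Definition monomial_map (k : fieldType) (n : nat)
    (a : 'I_n.+1 -> 'X_{1..n.+1}) : (n.+1).-tuple {mpoly k[n.+1]} :=
  [tuple 'X_[a i] | i < n.+1].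

(* Main.v *)
Require Import Defs.
From HB Require Import structures.
From mathcomp Require Import all_boot all_order all_algebra.
From mathcomp Require Import ring_quotient fraction.
From mathcomp.multinomials Require Import mpoly.
From mathcomp Require Import perm vector falgebra fieldext zify ring.
From Stdlib Require Import ClassicalEpsilon.
Import Order.TTheory GRing.Theory Num.Theory.
Local Open Scope ring_scope.

(** Let A be the matrix of exponents of f_0, ..., f_n, all of whose rows sum to
    d. Dominance means that det A is nonzero (dominant_det_neq0), hence any
    set S of rows has nonzero entries in at least #|S| columns; call S critical
    if it has them in exactly #|S| columns.

    Suppose there are two disjoint nonempty critical sets S1 and S2. Then d
    divides deg f (map_degree_dvd). Indeed there is a Z / (det A)-grading of the
    Laurent monomials, given by integral weights w of the variables
    (critical_weights), in which all the f_i have degree 0 while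
    y = x_t1 / x_t2 has a degree of order d, where t1 and t2 are columns met by
    S1 and S2. So a relation between powers of y with coefficients in
    K = f^*(k(P^n)) splits into relations that only involve exponents in one
    class modulo d (weight_relation_split). The minimal polynomial of y over K
    then has degree divisible by d, and so has k(P^n) over K by the tower law
    (extension_degree_dvd).

    Otherwise any two nonempty critical sets meet, and a minimal one contains a
    row e such that any nonempty set S of rows other than e involves more than
    #|S| columns. The columns can then be 2-coloured so that every row other
    than e involves both colours (bicoloring): the colours are signs of vectors
    in the kernel of A with rows deleted. The smaller colour class, with at most
    one more column added for e, is a set J of at most (n + 2) / 2 variables
    such that every f_i is divisible by one of them (small_transversal).
    The coordinate subspace where the variables of J vanish lies in the
    indeterminacy locus, and its dimension n - #|J| is at least (n - 2) / 2
    (coord_subspace_dim). *)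

Set Implicit Arguments.
Unset Strict Implicit.
Unset Printing Implicit Defensive.

(** * Transversals of nonnegative matrices *)

Section Hypergraph.
Variables (I V : finType) (A : I -> V -> nat).
Implicit Types (S R : {set I}) (J : {set V}).

Definition cols S : {set V} := [set v | [exists i in S, (0 < A i v)%N]].

Lemma colsP S v :
  reflect (exists2 i, i \in S & (0 < A i v)%N) (v \in cols S).
Proof. by rewrite inE; exact: 'exists_in_idP. Qed.

Lemma colsU S1 S2 : cols (S1 :|: S2) = cols S1 :|: cols S2.
Proof.
apply/setP => v; rewrite in_setU; apply/colsP/orP.
  by case=> i; rewrite in_setU => /orP[] Si Ai; [left|right]; apply/colsP; exists i.
by case=> /colsP[i Si Ai]; exists i => //; rewrite in_setU Si ?orbT.
Qed.

Lemma colsI_sub S1 S2 : cols (S1 :&: S2) \subset cols S1 :&: cols S2.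
Proof.
apply/subsetP => v /colsP[i]; rewrite in_setI => /andP[S1i S2i] Ai.
by rewrite in_setI; apply/andP; split; apply/colsP; exists i.
Qed.

(** Fewer equations than unknowns: the rows of S give #|S| linear equations in
    the unknowns indexed by the columns they involve. *)
Lemma kernel_vector S : (#|S| < #|cols S|)%N ->
  exists x : V -> rat,
    (exists2 v, v \in cols S & x v != 0) /\
    (forall i, i \in S -> \sum_v (A i v)%:R * x v = 0).
Proof.
set T := cols S => ltST.
pose B : 'M[rat]_(#|T|, #|S|) :=
  \matrix_(v, i) (A (enum_val i) (enum_val v))%:R.
have : kermx B != 0.
  by rewrite -mxrank_eq0 mxrank_ker subn_eq0 -ltnNge (leq_ltn_trans (rank_leq_col B)).
case/rowV0Pn => u /sub_kermxP uB0 u_neq0.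
pose x v := \sum_(j | enum_val j == v) u 0 j.
have xE j : x (enum_val j) = u 0 j.
  by rewrite /x (big_pred1 j) // => l /=; rewrite (inj_eq enum_val_inj).
exists x; split.
- have [j uj] : exists j, u 0 j != 0.
    apply/existsP; apply: contraNT u_neq0 => /existsPn u0.
    by apply/eqP/rowP => j; rewrite mxE; apply/eqP; have := u0 j; rewrite negbK.
  by exists (enum_val j); rewrite ?xE // enum_valP.
- move=> i iS; have := congr1 (fun M : 'rV_ _ => M 0 (enum_rank_in iS i)) uB0.
  rewrite !mxE => uBi; apply: etrans uBi.
  rewrite /x; under eq_bigr => v _ do rewrite big_distrr /=.
  rewrite (exchange_big_dep predT) //=; apply: eq_bigr => j _.
  by rewrite (big_pred1 (enum_val j)) 1?mulrC ?mxE ?enum_rankK_in // => v /=; rewrite eq_sym.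
Qed.

(** A nonzero vector x in the kernel of the rows of R colours the columns where
    it does not vanish by its sign: since A is nonnegative, a row that meets the
    support of x sees both signs, as its entries weighted by x sum to zero. The
    rows that miss the support of x are fewer and still satisfy the surplus
    condition, so induction colours the remaining columns for them. *)
Lemma bicoloring R :
    (forall S, S \subset R -> S != set0 -> (#|S| < #|cols S|)%N) ->
  exists c : pred V, forall i, i \in R ->
    (exists2 v, (0 < A i v)%N & c v) /\ (exists2 v, (0 < A i v)%N & ~~ c v).
Proof.
have [r leRr] := ubnP #|R|; elim: r R leRr => // r IHr R leRr surplus.
have [->|R_neq0] := eqVneq R set0; first by exists predT => i; rewrite inE.
have [x [[v0 /colsP[i0 Ri0 Ai0] xv0] kerx]] :=
  kernel_vector (surplus R (subxx R) R_neq0).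
pose R' := [set i in R | [forall v, (0 < A i v)%N ==> (x v == 0)]].
have sR'R : R' \subset R by apply/subsetP => i; rewrite inE => /andP[].
have i0R' : i0 \notin R'.
  rewrite inE Ri0 /=; apply/forallPn; exists v0.
  by rewrite Ai0 (negPf xv0).
have ltR' : (#|R'| < r)%N.
  apply: leq_trans (_ : #|R| <= r)%N; last by rewrite -ltnS.
  apply: proper_card; rewrite properE sR'R /=; apply/subsetPn; by exists i0.
have [c' c'P] := IHr R' ltR' (fun S sS => surplus S (subset_trans sS sR'R)).
exists (fun v => if x v == 0 then c' v else 0 < x v) => i Ri.
have [R'i|] := boolP (i \in R').
  have [[v Av cv] [v' Av' cv']] := c'P i R'i.
  move: R'i; rewrite inE Ri => /forallP xi0.
  by split; [exists v|exists v'] => //;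
    rewrite (implyP (xi0 _)).
rewrite inE Ri /= => /forallPn[v1]; rewrite negb_imply => /andP[Av1 xv1].
(* If x had one sign on row i, all terms of a vanishing sum would vanish,
   including the one at v1. *)
have zero_of_sign : forall s : rat,
    s != 0 -> (forall v, (0 < A i v)%N -> 0 <= s * x v) -> False.
  move=> s s0 sx.
  have : \sum_v (A i v)%:R * (s * x v) = 0.
    under eq_bigr => v _ do rewrite mulrCA.
    by rewrite -big_distrr /= kerx // mulr0.
  move/eqP; rewrite psumr_eq0 => [|v _]; last first.
    have [->|Av] := posnP (A i v); first by rewrite mul0r.
    by rewrite mulr_ge0 ?ler0n // sx.
  move/allP => /(_ v1 (mem_index_enum _)).
  by rewrite !mulf_eq0 (negPf xv1) (negPf s0) pnatr_eq0 -leqn0 leqNgt Av1.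
split; apply/exists_inP; apply: contraT => /exists_inPn noc; exfalso.
- apply: (zero_of_sign (-1)) => // v Av.
  have := noc v Av; rewrite mulN1r oppr_ge0.
  by case: eqP => [-> //|_]; rewrite -leNgt.
- apply: (zero_of_sign 1) => // v Av.
  have := noc v Av; rewrite mul1r.
  by case: eqP => [-> //|_]; rewrite negbK => /ltW.
Qed.

(** Under the Hall condition the rows S with #|cols S| = #|S|, called
    critical, are stable under nonempty intersection (#|cols S| is
    submodular). If no two nonempty ones are disjoint, a minimal one S0 lies in
    all of them, and deleting one row e of S0 leaves a surplus on every set of
    remaining rows. Each of the two colour classes X and Y of bicoloring then
    meets every row but e; the smaller class, completed by a column of e when it
    is strictly smaller, is the transversal. In case of equality no completion
    is needed, because the row e meets one of the two classes. *)
Lemma small_transversal :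
    (0 < #|I|)%N -> #|I| = #|V| ->
    (forall S, #|S| <= #|cols S|)%N ->
    (forall S1 S2, S1 != set0 -> S2 != set0 -> [disjoint S1 & S2] ->
       #|cols S1| = #|S1| -> #|cols S2| = #|S2| -> False) ->
  exists2 J : {set V}, (#|J|.*2 <= #|V|.+1)%N &
    forall i, exists2 v, v \in J & (0 < A i v)%N.
Proof.
move=> I_gt0 IV hall nodisj.
pose critical S := (S != set0) && (#|cols S| <= #|S|)%N.
have critT : critical setT.
  rewrite /critical -card_gt0 cardsT I_gt0 IV; exact: max_card.
case: (arg_minnP (fun S => #|S|) critT) => S0 /andP[S0n0 crit0] min0.
have [e S0e] := set0Pn _ S0n0.
have [|c cP] := @bicoloring [set~ e].
  move=> S sS Sn0; rewrite ltnNge; apply/negP => critS.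
  have [S0S|S0Sn0] := eqVneq (S :&: S0) set0.
    apply: (nodisj S S0) => //; first by rewrite -setI_eq0 S0S.
      by apply/eqP; rewrite eqn_leq critS hall.
    by apply/eqP; rewrite eqn_leq crit0 hall.
  have ltS : (#|S :&: S0| < #|S0|)%N.
    apply: proper_card; rewrite properE subsetIr /=; apply/subsetPn; exists e => //.
    apply/negP; rewrite in_setI => /andP[/(subsetP sS)]; by rewrite !inE eqxx.
  have /min0 : critical (S :&: S0); last by rewrite leqNgt ltS.
  rewrite /critical S0Sn0 /=.
  have h1 := subset_leq_card (colsI_sub S S0).
  have h2 := hall (S :|: S0); rewrite colsU in h2.
  have h3 := cardsUI S S0; have h4 := cardsUI (cols S) (cols S0).
  lia.
have [v0 Av0] : exists v, (0 < A e v)%N.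
  have := hall [set e]; rewrite cards1 card_gt0 => /set0Pn[v /colsP[i]].
  by rewrite inE => /eqP -> Av; exists v.
pose X := [set v | c v]; pose Y := [set v | ~~ c v].
have cardXY : (#|X| + #|Y| = #|V|)%N.
  by rewrite -(cardsC X); congr (_ + _)%N; apply: eq_card => v; rewrite !inE.
have hitX i : i != e -> exists2 v, v \in X & (0 < A i v)%N.
  by move=> ie; have [|[v Av cv] _] := cP i; rewrite ?inE //; exists v; rewrite ?inE.
have hitY i : i != e -> exists2 v, v \in Y & (0 < A i v)%N.
  by move=> ie; have [|_ [v Av cv]] := cP i; rewrite ?inE //; exists v; rewrite ?inE.
have addv0 (Z : {set V}) : (forall i, i != e -> exists2 v, v \in Z & (0 < A i v)%N) ->
  forall i, exists2 v, v \in v0 |: Z & (0 < A i v)%N.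
  move=> hitZ i; have [->|/hitZ[v Zv Av]] := eqVneq i e; [exists v0|exists v] => //.
    by rewrite setU11.
  by rewrite setU1r.
have cv (Z : {set V}) := cardsU1 v0 Z.
have [ltXY|ltYX|eqXY] := ltngtP #|X| #|Y|.
- exists (v0 |: X); last exact: addv0.
  by rewrite cv; case: (v0 \notin X); lia.
- exists (v0 |: Y); last exact: addv0.
  by rewrite cv; case: (v0 \notin Y); lia.
- have [Xv0|Xv0] := boolP (v0 \in X).
    exists X; first by lia.
    by move=> i; have [->|/hitX//] := eqVneq i e; exists v0.
  exists Y; first by lia.
  move=> i; have [->|/hitY//] := eqVneq i e; exists v0 => //.
  by move: Xv0; rewrite !inE.
Qed.

End Hypergraph.

(** * Weights attached to disjoint critical sets *)

Section CriticalWeights.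
Variables (N : nat) (A : 'I_N -> 'I_N -> nat).
Let M : 'M[int]_N := \matrix_(i, j) (A i j)%:Z.
Hypothesis detM : \det M != 0.

(** A nonzero term of the Leibniz expansion. *)
Lemma det_matching : exists s : 'S_N, forall i, (0 < A i (s i))%N.
Proof.
suff /existsP[s /forallP sP] : [exists s : 'S_N, [forall i, 0 < A i (s i)]%N].
  by exists s.
apply: contraNT detM => /existsPn nos.
rewrite /determinant big1 // => s _.
have /forallPn[i] := nos s; rewrite -leqNgt leqn0 => /eqP Ai.
by rewrite (bigD1 i) //= mxE Ai mul0r mulr0.
Qed.

Lemma det_hall (S : {set 'I_N}) : (#|S| <= #|cols A S|)%N.
Proof.
have [s sP] := det_matching.
rewrite -(card_imset S (@perm_inj _ s)); apply: subset_leq_card.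
by apply/subsetP => j /imsetP[i Si ->]; apply/colsP; exists i.
Qed.

(** In a nonzero term of the expansion of the cofactor, the permutation maps S
    onto cols S, so it cannot also send the row i outside S to the column j
    of cols S. *)
Lemma cofactor_critical (S : {set 'I_N}) i j : #|cols A S| = #|S| ->
  i \notin S -> j \in cols A S -> cofactor M i j = 0.
Proof.
move=> critS Si Tj; rewrite expand_cofactor big1 // => s /eqP sij.
suff [l Sl /eqP Al] : exists2 l, l \in S & A l (s l) == 0%N.
  rewrite (bigD1 l) /= ?mxE ?Al ?mul0r ?mulr0 //.
  by apply: contraNneq Si => ->.
apply/exists_inP; apply: contraT => /exists_inPn Apos.
have sST : s @: S = cols A S.
  apply/eqP; rewrite eqEcard card_imset ?critS ?leqnn ?andbT; last exact: perm_inj.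
  by apply/subsetP => _ /imsetP[l Sl ->]; apply/colsP; exists l; rewrite ?lt0n ?Apos.
move: Tj; rewrite -sST -sij => /imsetP[l Sl /perm_inj il].
by rewrite il Sl in Si.
Qed.

(** For w = adj M * 1_S1 one has M w = (det M) * 1_S1. Seen over the rationals,
    w / det M solves a system that is block triangular for S1 and for S2: on the
    columns of S1 it is the constant 1 / d, because the rows of S1 sum to d, and
    on the columns of S2 it vanishes. The vanishing of cofactors makes this
    precise without dividing. *)
Lemma critical_weights (d : nat) (S1 S2 : {set 'I_N}) :
    (forall i, \sum_j A i j = d)%N ->
    S1 != set0 -> S2 != set0 -> [disjoint S1 & S2] ->
    #|cols A S1| = #|S1| -> #|cols A S2| = #|S2| ->
  exists (w : 'I_N -> int) (t1 t2 : 'I_N),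
    [/\ forall i, (\det M %| \sum_j (A i j)%:Z * w j)%Z,
        w t1 * d%:Z = \det M & w t2 = 0].
Proof.
move=> rowsum S1n0 S2n0 dis crit1 crit2.
have cols_neq0 S : S != set0 -> exists t, t \in cols A S.
  by move=> Sn0; apply/set0Pn; rewrite -card_gt0 (leq_trans _ (det_hall S)) ?card_gt0.
have [t1 Tt1] := cols_neq0 _ S1n0; have [t2 Tt2] := cols_neq0 _ S2n0.
pose w j := \sum_(i in S1) \adj M j i.
exists w, t1, t2; split.
- move=> i; under eq_bigr => j _ do rewrite big_distrr /=.
  rewrite exchange_big /=; apply: rpred_sum => l _.
  have /matrixP /(_ i l) := mul_mx_adj M; rewrite !mxE => adjE.
  under eq_bigr => j _.
    have <- : M i j = (A i j)%:Z by rewrite mxE.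
    over.
  by rewrite adjE; case: (i == l); rewrite ?mulr1n ?mulr0n ?dvdz0 ?dvdzz.
- pose T1 := cols A S1.
  have /matrixP /(_ t1) adjE := mul_adj_mx M.
  have : \sum_(l in T1) (\det M)%:M t1 l = \det M :> int.
    rewrite (bigD1 t1) //= big1 ?addr0 => [|l /andP[_ /negPf lt]]; rewrite mxE.
      by rewrite eqxx.
    by rewrite eq_sym lt.
  move=> <-; under eq_bigr => l _ do rewrite -adjE mxE.
  rewrite exchange_big /= big_distrl /= [RHS](bigID (mem S1)) /=.
  rewrite [X in _ = _ + X]big1 ?addr0 => [|i Si]; last first.
    by apply: big1 => l _; rewrite mxE (@cofactor_critical S1) ?mul0r.
  apply: eq_bigr => i Si; rewrite -big_distrr /=; congr (_ * _).
  rewrite -(rowsum i) (bigID (mem T1)) /= [X in (_ + X)%N]big1 ?addn0.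
    by rewrite -natz natr_sum; apply: eq_bigr => l _; rewrite mxE natz.
  move=> l Tl; apply/eqP; apply: contraNT Tl; rewrite -lt0n => Al.
  by apply/colsP; exists i.
- rewrite /w big1 // => i Si; rewrite mxE (@cofactor_critical S2) //.
  apply/negP => S2i; move: dis; rewrite disjoint_subset => /subsetP/(_ i Si).
  by rewrite inE S2i.
Qed.

End CriticalWeights.

(** * Divisibility of field degrees *)

Record subfield_type (F : fieldType) (S : divringClosed F) := SubfieldElt {
  subfield_val : F;
  subfield_valP : subfield_val \in S
}.

Section SubfieldType.
Variables (F : fieldType) (S : divringClosed F).
HB.instance Definition _ := [isSub for @subfield_val F S].
HB.instance Definition _ := [Choice of subfield_type S by <:].
HB.instance Definition _ :=
  GRing.SubChoice_isSubIntegralDomain.Build F _ (subfield_type S)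
    (divringClosedP S).
Fact subfield_unit : {mono (val : subfield_type S -> F) : u / u \in GRing.unit}.
Proof. by []. Qed.
HB.instance Definition _ :=
  GRing.SubIntegralDomain_isSubField.Build F _ (subfield_type S) subfield_unit.
End SubfieldType.

(** A pair of subfields of F with a basis of the larger one over the smaller
    one; bundling the coordinates makes the larger field a canonical
    finite-dimensional extension of the smaller one, hence subject to the tower
    law field_dimS. *)
Record finite_extension (F : fieldType) := FiniteExtension {
  fe_base : divringClosed F;
  fe_top : divringClosed F;
  fe_sub : forall x, x \in fe_base -> x \in fe_top;
  fe_dim : nat;
  fe_basis : 'I_fe_dim -> subfield_type fe_top;
  fe_coord : subfield_type fe_top -> 'I_fe_dim -> subfield_type fe_base;
  fe_span : forall z, val z = \sum_i val (fe_coord z i) * val (fe_basis i);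
  fe_free : forall c : 'I_fe_dim -> subfield_type fe_base,
    \sum_i val (c i) * val (fe_basis i) = 0 -> forall i, c i = 0
}.

Definition fe_type (F : fieldType) (E : finite_extension F) : Type :=
  subfield_type (fe_top E).

Section FiniteExtensionType.
Variables (F : fieldType) (E : finite_extension F).
Local Notation K := (subfield_type (fe_base E)).
Local Notation L := (fe_type E).

HB.instance Definition _ := GRing.Field.on L.

Definition fe_incl (a : K) : L := Sub (val a) (fe_sub (valP a)).
Definition fe_scale (a : K) (u : L) : L := fe_incl a * u.

Fact fe_scaleA a b u : fe_scale a (fe_scale b u) = fe_scale (a * b) u.
Proof. by apply: val_inj; rewrite /= mulrA. Qed.
Fact fe_scale1 u : fe_scale 1 u = u.
Proof. by apply: val_inj; rewrite /= mul1r. Qed.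
Fact fe_scaleDr a u v : fe_scale a (u + v) = fe_scale a u + fe_scale a v.
Proof. by apply: val_inj; rewrite /= mulrDr. Qed.
Fact fe_scaleDl v a b : fe_scale (a + b) v = fe_scale a v + fe_scale b v.
Proof. by apply: val_inj; rewrite /= mulrDl. Qed.

HB.instance Definition _ := GRing.Zmodule_isLmodule.Build K L
  fe_scaleA fe_scale1 fe_scaleDr fe_scaleDl.

Fact fe_scaleAl (a : K) (u v : L) : a *: (u * v) = (a *: u) * v.
Proof. exact: mulrA. Qed.
HB.instance Definition _ := GRing.Lmodule_isLalgebra.Build K L fe_scaleAl.

Fact fe_scaleAr (a : K) (u v : L) : a *: (u * v) = u * (a *: v).
Proof. exact: mulrCA. Qed.
HB.instance Definition _ := GRing.Lalgebra_isAlgebra.Build K L fe_scaleAr.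

Fact fe_vector_axiom : Vector.axiom (fe_dim E) L.
Proof.
pose r2v (r : 'rV[K]_(fe_dim E)) : L := \sum_i r 0 i *: (fe_basis i : L).
pose v2r (z : L) : 'rV[K]_(fe_dim E) := \row_i fe_coord z i.
have val_r2v r : val (r2v r) = \sum_i val (r 0 i) * val (fe_basis i : L) :> F.
  by rewrite raddf_sum; apply: eq_bigr => i _.
have v2rK : cancel v2r r2v.
  move=> z; apply: val_inj; rewrite val_r2v [RHS]fe_span.
  by apply: eq_bigr => i _; rewrite mxE.
have r2v_lin : linear r2v.
  move=> a u v; rewrite /r2v scaler_sumr -big_split /=; apply: eq_bigr => i _.
  by rewrite scalerA -scalerDl !mxE.
pose r2vlM := GRing.isLinear.Build _ _ _ _ r2v r2v_lin.
pose r2vL : {linear _ -> _} := HB.pack r2v r2vlM.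
have r2v_inj : injective r2vL.
  apply: raddf_inj => r r0; apply/rowP => i; rewrite mxE.
  apply: (fe_free (c := fun i => r 0 i)); rewrite -val_r2v.
  by have -> : r2v r = 0 by [].
have r2vK : cancel r2vL v2r by move=> r; apply: r2v_inj; rewrite /= v2rK.
by exists v2r; [apply: (can2_linear (f := r2vL)) | exists r2v].
Qed.
HB.instance Definition _ := Lmodule_hasFinDim.Build K L fe_vector_axiom.

Lemma fe_dimE : \dim {:L} = fe_dim E.
Proof. by rewrite dimvf. Qed.

End FiniteExtensionType.


(** The degree of L is a multiple of the degree e of the minimal polynomial p of
    y, so it suffices that d divides e. The part of p with exponents congruent
    to e modulo d still annihilates y; dividing it by y ^+ r, where r is the
    remainder of e modulo d, gives a nonzero polynomial of degree e - r that
    annihilates y, whence r = 0. *)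
Lemma dim_dvd_of_relations (F0 : fieldType) (L : fieldExtType F0) (y : L) (d : nat) :
    y != 0 ->
    (forall p : {poly L}, p \is a polyOver 1%VS -> p.[y] = 0 ->
       forall r, \sum_(i < size p | (i %% d == r)%N) p`_i * y ^+ i = 0) ->
  (d %| \dim {:L})%N.
Proof.
move=> y_neq0 split_rel.
pose p := minPoly 1%AS y; pose e := adjoin_degree 1%AS y.
have size_p : size p = e.+1 by exact: size_minPoly.
suff : (d %| e)%N.
  move/dvdn_trans; apply; have := field_dimS (subvf <<1; y>>%AS).
  by rewrite dim_Fadjoin dimv1 muln1.
pose r := (e %% d)%N; have le_re : (r <= e)%N by exact: leq_mod.
pose q := \poly_(i < (e - r).+1) (if ((i + r) %% d == r)%N then p`_(i + r) else 0).
have p1 : p \is a polyOver 1%VS by exact: minPolyOver.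
have q1 : q \is a polyOver 1%VS.
  apply: polyOver_poly => i _; case: ifP => _; [exact: (polyOverP p1)|exact: mem0v].
have qy : q.[y] = 0.
  apply: (mulIf (expf_neq0 r y_neq0)).
  rewrite mul0r -(split_rel p p1 (minPolyxx _ _) r) size_p.
  rewrite horner_poly big_distrl /=.
  rewrite -(big_mkord (fun i => i %% d == r)%N (fun i => p`_i * y ^+ i)).
  rewrite (big_cat_nat (leq0n r) (leqW le_re)) /=.
  rewrite [X in _ = X + _]big_nat_cond [X in _ = X + _]big_pred0 ?add0r => [|i].
    rewrite -[X in index_iota X _]add0n big_addn subSn // big_mkord [RHS]big_mkcond /=.
    apply: eq_bigr => i _; case: ifP => _; last by rewrite !mul0r.
    by rewrite -mulrA -exprD.
  by case: ltnP => //= lt_ir; apply: contraTF lt_ir => /eqP <-; rewrite -leqNgt leq_mod.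
have q_lead : q`_(e - r) = 1.
  rewrite coef_poly leqnn subnK // eqxx.
  by have /monicP := monic_minPoly 1%AS y; rewrite /lead_coef -/p size_p.
have /dvdp_leq : minPoly 1%AS y %| q by apply: minPoly_dvdp => //; apply/rootP.
rewrite -/p size_p => /(_ _) le_eq.
have q_neq0 : q != 0.
  by apply/eqP => q0; move: q_lead; rewrite q0 coef0 => /eqP; rewrite eq_sym oner_eq0.
have := leq_trans (le_eq q_neq0) (size_poly _ _).
rewrite ltnS => le_e; rewrite /dvdn -/r; lia.
Qed.

(** The same for subfields given by predicates on an ambient field: classically
    the predicates are decidable, and the basis and coordinates supplied by
    extension_degree turn the pair into a finite_extension. *)
Lemma extension_degree_dvd (F : fieldType) (K L : F -> Prop) (m d : nat) (y : F) :
    K 1 -> (forall x z, K x -> K z -> K (x - z)) ->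
    (forall x z, K x -> K z -> K (x / z)) ->
    L 1 -> (forall x z, L x -> L z -> L (x - z)) ->
    (forall x z, L x -> L z -> L (x / z)) ->
    (forall x, K x -> L x) ->
    extension_degree K L m -> L y -> y != 0 ->
    (forall s (c : nat -> F), (forall i, K (c i)) ->
       \sum_(i < s) c i * y ^+ i = 0 ->
       forall r, \sum_(i < s | (i %% d == r)%N) c i * y ^+ i = 0) ->
  (d %| m)%N.
Proof.
move=> K1 KB KV L1 LB LV KL [b [Lb span free]] Ly y_neq0 split_rel.
pose dec (P : F -> Prop) : {pred F} :=
  fun x => if excluded_middle_informative (P x) then true else false.
have decP P x : reflect (P x) (x \in dec P).
  by rewrite unfold_in; case: excluded_middle_informative => h; constructor.
have closed P : P 1 -> (forall x z, P x -> P z -> P (x - z)) ->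
    (forall x z, P x -> P z -> P (x / z)) -> divring_closed (dec P).
  by move=> P1 PB PV; split=> [|x z|x z]; [|move=> /decP Px /decP Pz..]; apply/decP; auto.
pose decK : divringClosed F := HB.pack (dec K)
  (GRing.isDivringClosed.Build F (dec K) (closed K K1 KB KV)).
pose decL : divringClosed F := HB.pack (dec L)
  (GRing.isDivringClosed.Build F (dec L) (closed L L1 LB LV)).
have decKL x : x \in decK -> x \in decL by move=> /decP/KL Lx; apply/decP.
have decLb i : b i \in decL by apply/decP.
pose basis i : subfield_type decL := Sub (b i) (decLb i).
have coordP (z : subfield_type decL) :
    {c : 'I_m -> subfield_type decK | val z = \sum_i val (c i) * val (basis i)}.
  apply: constructive_indefinite_description.
  have /decP /span [c [Kc zE]] := subfield_valP z.
  have decKc i : c i \in decK by apply/decP.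
  exists (fun i => Sub (c i) (decKc i)); exact: zE.
have basis_free (c : 'I_m -> subfield_type decK) :
    \sum_i val (c i) * val (basis i) = 0 -> forall i, c i = 0.
  move=> c0 i; apply: val_inj; apply: (free (fun i => val (c i))) => // j.
  by have /decP := subfield_valP (c j).
pose E := FiniteExtension decKL (fun z => svalP (coordP z)) basis_free.
have <- : \dim {:fe_type E} = m by exact: fe_dimE.
have decLy : y \in decL by apply/decP.
pose y' : fe_type E := Sub y decLy.
apply: (@dim_dvd_of_relations _ _ y').
  by apply: contraNneq y_neq0 => /(congr1 val) /= ->.
move=> p p1 py r; apply: val_inj.
have val_exp j : val (y' ^+ j : fe_type E) = y ^+ j :> F.
  by elim: j => // j IHj; rewrite !exprS -IHj.
have val_sum (I : finType) (P : pred I) (f : I -> nat) :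
  val (\sum_(i | P i) p`_(f i) * y' ^+ f i : fe_type E) =
    \sum_(i | P i) val (p`_(f i)) * y ^+ f i :> F.
  by rewrite raddf_sum; apply: eq_bigr => i _; rewrite -val_exp.
rewrite (val_sum _ (fun i : 'I__ => i %% d == r)%N (@nat_of_ord _)).
apply: (split_rel (size p) (fun i => val p`_i)).
  move=> i; have /vlineP[a ->] := polyOverP p1 i.
  have /decP := subfield_valP a.
  by rewrite /= mulr1.
by rewrite -(val_sum _ predT (@nat_of_ord _)) -horner_coef py.
Qed.

(** * Coordinate subspaces of projective space *)

Section CoordinateSubspaces.
Variables (k : fieldType) (n : nat).
Local Notation R := {mpoly k[n.+1]}.
Implicit Types (J : {set 'I_n.+1}) (m : 'X_{1..n.+1}) (u v : R).

Definition kill J : n.+1.-tuple R := [tuple if j \in J then 0 else 'X_j | j < n.+1].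

(** The ideal generated by the variables 'X_j with j in J, as the kernel of the
    substitution that kills them: it is then an ideal, and prime, for free. *)
Definition coord_ideal J : {pred R} := [pred u | u \mPo kill J == 0].

Lemma coord_idealE J u : (u \in coord_ideal J) = (u \mPo kill J == 0).
Proof. by []. Qed.

Lemma kill_mon J m :
  'X_[m] \mPo kill J = if [exists j in J, (0 < m j)%N] then 0 else 'X_[m] :> R.
Proof.
rewrite comp_mpolyX; case: exists_inP => [[j Jj mj]|noJ].
  by rewrite (bigD1 j) //= tnth_mktuple Jj expr0n -[_ == _]negbK -lt0n mj mul0r.
rewrite [RHS]mpolyXE_id; apply: eq_bigr => j _; rewrite tnth_mktuple.
case: ifP => // Jj; suff -> : m j = 0%N by rewrite !expr0.
by apply/eqP; rewrite -leqn0 leqNgt; apply/negP => mj; apply: noJ; exists j.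
Qed.

Lemma killE J u :
  u \mPo kill J = \sum_(m <- msupp u | ~~ [exists j in J, (0 < m j)%N]) u@_m *: 'X_[m].
Proof.
rewrite {1}(mpolyE u) raddf_sum /= [RHS]big_mkcond; apply: eq_bigr => m _.
by rewrite comp_mpolyZ kill_mon; case: ifP; rewrite ?scaler0.
Qed.

Lemma coord_idealP J u :
  reflect (forall m, m \in msupp u -> exists2 j, j \in J & (0 < m j)%N)
          (u \in coord_ideal J).
Proof.
rewrite coord_idealE killE; apply: (iffP eqP) => [u0 m um|uJ].
  apply/exists_inP; apply: contraT => mJ.
  have := congr1 (mcoeff m) u0; rewrite mcoeff0 raddf_sum /= -big_filter.
  rewrite (bigD1_seq m) ?filter_uniq ?msupp_uniq ?mem_filter ?mJ //=.
  rewrite big1 ?addr0 => [|m' /negPf m'm]; rewrite mcoeffZ mcoeffX.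
    by rewrite eqxx mulr1 => /eqP; rewrite mcoeff_eq0 um.
  by rewrite m'm mulr0.
by rewrite big_seq_cond big_pred0 // => m; apply/negP => /andP[/uJ/exists_inP ->].
Qed.

Fact coord_idealr J : idealr_closed (coord_ideal J).
Proof.
split; rewrite ?coord_idealE ?comp_mpoly0 ?eqxx ?comp_mpoly1 ?oner_eq0 // => u v w.
by rewrite !coord_idealE rmorphD rmorphM /= => /eqP -> /eqP ->; rewrite mulr0 addr0.
Qed.

Fact coord_ideal_prime J : prime_idealr_closed (coord_ideal J).
Proof. by move=> u v; rewrite !coord_idealE rmorphM mulf_eq0. Qed.

Fact coord_ideal_homog J e u :
  u \in coord_ideal J -> pihomog mdeg e u \in coord_ideal J.
Proof.
move=> /coord_idealP uJ; apply/coord_idealP => m um; apply: uJ.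
move: um; rewrite pihomogE => /msupp_sum_le /flatten_mapP[m'].
by rewrite mem_filter => /andP[_ um'] /msuppZ_le; rewrite msuppX inE => /eqP ->.
Qed.

Lemma coord_idealX J j : ('X_j \in coord_ideal J) = (j \in J).
Proof.
rewrite coord_idealE comp_mpolyXU -tnth_nth tnth_mktuple.
by case: ifP; rewrite ?eqxx // -msupp_eq0 msuppX.
Qed.

Fact coord_ideal_relevant J : J != setT -> exists j, 'X_j \notin coord_ideal J.
Proof.
rewrite -subTset => /subsetPn[j _ Jj]; by exists j; rewrite coord_idealX.
Qed.

Definition coord_point J (JT : J != setT) : proj_point k n :=
  ProjPoint (coord_idealr J) (@coord_ideal_prime J) (@coord_ideal_homog J)
    (coord_ideal_relevant JT).

Definition coord_subspace J : proj_set k n :=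
  zero_locus (fun u => exists2 j, j \in J & u = 'X_j).

Lemma coord_subspaceP J (P : proj_point k n) :
  coord_subspace J P <-> forall j, j \in J -> 'X_j \in pt_ideal P.
Proof. by split=> [PJ j Jj|PJ u [j Jj ->]]; [apply: PJ; exists j|exact: PJ]. Qed.

Lemma pt_ideal_lin (P : proj_point k n) (a u v : R) :
  u \in pt_ideal P -> v \in pt_ideal P -> a * u + v \in pt_ideal P.
Proof. by case: (pt_idealr P) => _ _ h; apply: h. Qed.

Lemma pt_ideal0 (P : proj_point k n) : 0 \in pt_ideal P.
Proof. by case: (pt_idealr P). Qed.

Lemma pt_ideal_mon (P : proj_point k n) j m :
  'X_j \in pt_ideal P -> (0 < m j)%N -> 'X_[m] \in pt_ideal P.
Proof.
move=> Pj mj; have -> : 'X_[m] = 'X_[m - U_(j)] * 'X_j + 0 :> R.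
  rewrite addr0 -mpolyXD submK //; apply/mnm_lepP => i; rewrite mnm1E.
  by case: eqP => [<-|].
exact: pt_ideal_lin (pt_ideal0 P).
Qed.

(** coord_point J is the generic point of the coordinate subspace. *)
Lemma coord_subspace_generic J (P : proj_point k n) u :
  coord_subspace J P -> u \in coord_ideal J -> u \in pt_ideal P.
Proof.
move=> /coord_subspaceP PJ /coord_idealP uJ; rewrite (mpolyE u) big_seq.
apply: (big_ind (fun v => v \in pt_ideal P)) => [|v w Pv Pw|m um].
- exact: pt_ideal0.
- by rewrite -[v]mul1r; exact: pt_ideal_lin.
have [j Jj mj] := uJ m um.
rewrite -mul_mpolyC -[_ * _]addr0; apply: pt_ideal_lin (pt_ideal0 P).
exact: pt_ideal_mon (PJ j Jj) mj.
Qed.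

Lemma coord_point_subspace J J' (JT : J != setT) :
  coord_subspace J' (coord_point JT) <-> J' \subset J.
Proof.
rewrite coord_subspaceP; split=> [PJ|/subsetP sJ j /sJ Jj].
  by apply/subsetP => j /PJ; rewrite coord_idealX.
by rewrite /= coord_idealX.
Qed.

(** A closed set through the generic point contains the whole subspace, and the
    generic point lies in one of the two closed sets of any cover. *)
Lemma coord_subspace_irreducible J : J != setT -> irreducible_closed (coord_subspace J).
Proof.
move=> JT; have PJ : coord_subspace J (coord_point JT) by apply/coord_point_subspace.
split.
- exists (fun u => exists2 j, j \in J & u = 'X_j); split=> // u [j _ ->].
  by apply/homogP; exists 1%N; rewrite dhomogX; exact/eqP/mdeg1.
- by exists (coord_point JT).
- have generic_sub A : zariski_closed A -> A (coord_point JT) ->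
      proj_sub (coord_subspace J) A.
    move=> [S [_ AS]] /AS SJ Q QJ; apply/AS => u /SJ.
    exact: coord_subspace_generic.
  by move=> A B clA clB /(_ _ PJ) [] ?; [left|right]; exact: generic_sub.
Qed.

(** Adjoin the remaining variables to J one at a time, in the order of a
    duplicate-free list s, stopping when one variable is left: this gives a
    chain of n - #|J| strict inclusions of coordinate subspaces, strict because
    each generic point sees which variables vanish. *)
Lemma coord_subspace_dim J (W : proj_set k n) (q : rat) :
  J != setT -> proj_sub (coord_subspace J) W ->
  q <= (n - #|J|)%N%:R -> dim_at_least W q.
Proof.
move=> JT JW le_q; pose s := enum (~: J).
(* The subspaces must grow with i, so Jc shrinks from all but the head of s at
   i = 0 down to J at i = n - #|J|. *)
pose Jc i := J :|: [set j in drop i.+1 s].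
have memJc i j : (j \in Jc i) = (j \in J) || (j \in drop i.+1 s) by rewrite !inE.
have size_s : size s = (n - #|J|).+1.
  have := cardsC J; rewrite card_ord /s -cardE.
  have : (0 < #|~: J|)%N by rewrite card_gt0 -setCT (inj_eq (@setC_inj _)).
  by lia.
have uniq_s : uniq s by exact: enum_uniq.
have [j0 _] : exists j, j \in ~: J.
  by apply/set0Pn; rewrite -setCT (inj_eq (@setC_inj _)).
have new i : (i < size s)%N -> nth j0 s i \notin Jc i.
  move=> lt_i; rewrite memJc negb_or.
  have := mem_nth j0 lt_i; rewrite mem_enum in_setC => -> /=.
  move: uniq_s; rewrite -{1}(cat_take_drop i s) cat_uniq => /and3P[_ _].
  by rewrite (drop_nth j0 lt_i) /= => /andP[].
have JcT i : (i < size s)%N -> Jc i != setT.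
  by move=> /new; apply: contraNneq => ->.
exists (n - #|J|)%N, (fun i => coord_subspace (Jc i)); split=> //; split.
- move=> i le_i; split; first by apply/coord_subspace_irreducible/JcT; rewrite size_s.
  move=> P /coord_subspaceP PJ; apply: JW; apply/coord_subspaceP => j Jj.
  by apply: PJ; rewrite memJc Jj.
- move=> i lt_i; split.
    move=> P /coord_subspaceP PJ; apply/coord_subspaceP => j; rewrite memJc => Jj.
    apply: PJ; rewrite memJc; case/orP: Jj => [->//|].
    by rewrite -[i.+2]add1n -drop_drop => /mem_drop ->; rewrite orbT.
  have lt_i1 : (i.+1 < size s)%N by rewrite size_s.
  move=> /(_ (coord_point (JcT _ lt_i1)))
    /(_ (iffRL (coord_point_subspace _ _) (subxx _))).
  move/coord_point_subspace/subsetP/(_ (nth j0 s i.+1)).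
  rewrite (negPf (new _ lt_i1)) memJc (drop_nth j0) // inE eqxx orbT.
  by move/(_ isT).
Qed.

Lemma indeterminacy_coord_subspace (a : 'I_n.+1 -> 'X_{1..n.+1}) J :
  (forall i, exists2 j, j \in J & (0 < a i j)%N) ->
  proj_sub (coord_subspace J) (indeterminacy_locus (monomial_map k a)).
Proof.
move=> hit P /coord_subspaceP PJ u /mapP[i _ ->].
by have [j /PJ Pj aij] := hit i; exact: pt_ideal_mon Pj aij.
Qed.

End CoordinateSubspaces.

(** * Monomial substitutions and dominance *)

Section MonomialSubstitution.
Variables (k : fieldType) (n d : nat) (a : 'I_n.+1 -> 'X_{1..n.+1}).
Hypothesis mdeg_a : forall i, mdeg (a i) = d.
Local Notation R := {mpoly k[n.+1]}.
Local Notation f := (monomial_map k a).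

Lemma monomial_map_mon m : 'X_[m] \mPo f = 'X_[\sum_i (a i *+ m i)] :> R.
Proof.
by rewrite comp_mpolyX -mprodXnE; apply: eq_bigr => i _; rewrite tnth_mktuple.
Qed.

Lemma monomial_map_homog e (u : R) : u \is e.-homog -> u \mPo f \is (e * d).-homog.
Proof.
move=> /dhomogP ue; rewrite {1}(mpolyE u) raddf_sum /= big_seq.
apply: rpred_sum => m /ue <-; rewrite comp_mpolyZ monomial_map_mon.
apply: rpredZ; rewrite dhomogX /=; apply/eqP.
rewrite mdeg_sum [mdeg m]mdegE big_distrl; apply: eq_bigr => i _ /=.
by rewrite mdegMn mdeg_a mulnC.
Qed.

(** An integral linear relation between the rows of the exponent matrix, split
    into its positive part p and its negative part q, gives a relation
    f^p = f^q between the monomials. As all rows sum to d, p and q have the same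
    degree, so the image of f lies in the hypersurface 'X_[p] = 'X_[q]; by
    dominance the generic point of the projective space does too. *)
Lemma dominant_det_neq0 : (0 < d)%N -> dominant f ->
  \det (\matrix_(i < n.+1, j < n.+1) (a i j)%:Z) != 0 :> int.
Proof.
move=> d_gt0 dom; apply/negP => /det0P[c c_neq0 cA].
pose x i : int := c 0 i.
pose p := [multinom if (0 <= x i)%R then absz (x i) else 0%N | i < n.+1].
pose q := [multinom if (0 <= x i)%R then 0%N else absz (x i) | i < n.+1].
have pqE i : x i = (p i)%:Z - (q i)%:Z.
  by rewrite /p /q !mnmE; case: ifP; lia.
have relj j : (\sum_i p i * a i j = \sum_i q i * a i j)%N.
  have /rowP/(_ j) := cA; rewrite !mxE => cAj.
  apply/eqP; rewrite -eqz_nat -!natz !natr_sum -subr_eq0 -sumrB -[X in _ == X]cAj.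
  apply/eqP/eq_bigr => i _; rewrite -[c 0 i]/(x i) mxE pqE; lia.
have mdeg_pq : mdeg p = mdeg q.
  apply/eqP; rewrite -(eqn_pmul2r d_gt0) !mdegE !big_distrl /=; apply/eqP.
  transitivity (\sum_i \sum_j p i * a i j)%N.
    by apply: eq_bigr => i _; rewrite -(mdeg_a i) mdegE big_distrr.
  rewrite exchange_big /=; under eq_bigr => j _ do rewrite relj.
  rewrite exchange_big /=; apply: eq_bigr => i _.
  by rewrite -(mdeg_a i) mdegE big_distrr.
pose u : R := 'X_[p] - 'X_[q].
have u_homog : u \is homog mdeg.
  by apply/homogP; exists (mdeg p); apply: rpredB; rewrite dhomogX /= ?mdeg_pq.
have uf : u \mPo f = 0.
  rewrite rmorphB /= !monomial_map_mon; apply/eqP; rewrite subr_eq0; apply/eqP.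
  congr ('X_[_]); apply/mnmP => j; rewrite !mnm_sumE.
  under eq_bigr => i _ do rewrite mulmnE mulnC.
  by rewrite relj; apply: eq_bigr => i _; rewrite mulmnE mulnC.
have nT : set0 != [set: 'I_n.+1] by rewrite eq_sym -card_gt0 cardsT card_ord.
have clC : zariski_closed (zero_locus (fun v : R => v = u)).
  by exists (fun v => v = u); split=> // v ->.
have : zero_locus (fun v : R => v = u) (coord_point k nT).
  by apply: dom clC _ _ => P Q [_ PQ] v ->; rewrite PQ uf pt_ideal0.
move=> /(_ u erefl) /coord_idealP u0.
have : p \in msupp u.
  rewrite mcoeff_msupp mcoeffB !mcoeffX eqxx.
  suff /negPf -> : q != p by rewrite subr0 oner_eq0.
  apply: contraNneq c_neq0 => qp; apply/eqP/rowP => i.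
  by rewrite -[c 0 i]/(x i) pqE qp subrr mxE.
by case/u0 => j; rewrite inE.
Qed.

End MonomialSubstitution.

(** * The weight grading and the degree of a monomial map *)

Section RatioField.
Variables (k F : fieldType) (N : nat) (phi : {rmorphism {mpoly k[N]} -> F}).

(** With phi = tofrac this is function_field, and with phi the substitution of f
    followed by tofrac it is pullback_field. Since x / 0 = 0, a denominator
    killed by phi yields 0, and phi need not be injective for these ratios to
    form a field. *)
Definition homogeneous_ratio (z : F) : Prop :=
  exists (e : nat) (u v : {mpoly k[N]}),
    [/\ u \is e.-homog, v \is e.-homog, v != 0 & z = phi u / phi v].

Lemma homogeneous_ratio1 : homogeneous_ratio 1.
Proof.
by exists 0%N, 1, 1; rewrite dhomog1 oner_neq0 !rmorph1 divr1; split.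
Qed.

Lemma homogeneous_ratio0 : homogeneous_ratio 0.
Proof.
by exists 0%N, 0, 1; rewrite dhomog0 dhomog1 oner_neq0 rmorph0 mul0r; split.
Qed.

Lemma homogeneous_ratioB x z :
  homogeneous_ratio x -> homogeneous_ratio z -> homogeneous_ratio (x - z).
Proof.
move=> [e [u [v [ue ve v0 ->]]]] [e' [u' [v' [ue' ve' v0' ->]]]].
have [pv|pv] := eqVneq (phi v) 0.
  exists e', (- u'), v'; split=> //; first by rewrite rpredN.
  by rewrite pv invr0 mulr0 sub0r rmorphN mulNr.
have [pv'|pv'] := eqVneq (phi v') 0.
  by exists e, u, v; split=> //; rewrite pv' invr0 mulr0 subr0.
exists (e + e')%N, (u * v' - v * u'), (v * v'); split.
- by rewrite rpredB ?dhomogM.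
- exact: dhomogM.
- exact: mulf_neq0.
- by rewrite -(mulNr (phi u')) addf_div // rmorphB !rmorphM mulNr [phi v * phi u']mulrC.
Qed.

Lemma homogeneous_ratioV x z :
  homogeneous_ratio x -> homogeneous_ratio z -> homogeneous_ratio (x / z).
Proof.
move=> [e [u [v [ue ve v0 ->]]]] [e' [u' [v' [ue' ve' v0' ->]]]].
have [->|u0'] := eqVneq u' 0.
  by rewrite rmorph0 mul0r invr0 mulr0; exact: homogeneous_ratio0.
exists (e + e')%N, (u * v'), (v * u'); split.
- exact: dhomogM.
- exact: dhomogM.
- exact: mulf_neq0.
- by rewrite !rmorphM invf_div mulf_div.
Qed.

End RatioField.

Lemma clear_denominators (F : fieldType) (u v q x z t : F) :
  v != 0 -> t != 0 -> u * q * (x * z) = u / v * (x / t) * (v * q * (z * t)).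
Proof. by move=> v0 t0; field; rewrite v0 t0. Qed.

Section WeightGrading.
Variables (k : fieldType) (n : nat) (w : 'I_n.+1 -> int) (D : int).
Local Notation R := {mpoly k[n.+1]}.

Definition weight (m : 'X_{1..n.+1}) : int := \sum_j (m j)%:Z * w j.

(** The grading of polynomials by weights modulo D: p is pure of class c when
    all its monomials have weight c modulo D. *)
Definition pure (c : int) (p : R) : Prop :=
  forall m, m \in msupp p -> (D %| weight m - c)%Z.

Lemma weightD m1 m2 : weight (m1 + m2) = weight m1 + weight m2.
Proof.
by rewrite /weight -big_split; apply: eq_bigr => j _; rewrite mnmDE PoszD mulrDl.
Qed.

Lemma weightU j : weight U_(j) = w j.
Proof.
rewrite /weight (bigD1 j) //= mnm1E eqxx mul1r big1 ?addr0 // => i /negPf ij.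
by rewrite mnm1E eq_sym ij mul0r.
Qed.

Lemma pureX m : pure (weight m) 'X_[m].
Proof. by move=> m'; rewrite msuppX inE => /eqP ->; rewrite subrr dvdz0. Qed.

Lemma pure1 : pure 0 1.
Proof.
move=> m; rewrite -mpolyX0 => /pureX; congr (_ %| _)%Z.
by congr (_ - _); rewrite /weight big1 // => j _; rewrite mnm0E mul0r.
Qed.

Lemma pureM c c' p q : pure c p -> pure c' q -> pure (c + c') (p * q).
Proof.
move=> pc qc m /msuppM_le/allpairsP[[m1 m2] /= [pm1 qm2 ->]].
by rewrite weightD opprD addrACA; apply: rpredD; [exact: pc|exact: qc].
Qed.

Lemma pureXn c p i : pure c p -> pure (i%:Z * c) (p ^+ i).
Proof.
move=> pc; elim: i => [|i IHi]; first by rewrite mul0r expr0; exact: pure1.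
by rewrite exprS intS mulrDl mul1r; exact: pureM.
Qed.

Lemma pure_prod (I : finType) (P : pred I) (F : I -> R) :
  (forall i, pure 0 (F i)) -> pure 0 (\prod_(i | P i) F i).
Proof.
move=> F0; apply: (big_ind (pure 0)) => // [|p q p0 q0]; first exact: pure1.
by rewrite -[0]addr0; exact: pureM.
Qed.

Lemma pure_monomial_map (a : 'I_n.+1 -> 'X_{1..n.+1}) (u : R) :
  (forall i, (D %| weight (a i))%Z) -> pure 0 (u \mPo monomial_map k a).
Proof.
move=> wa m; rewrite {1}(mpolyE u) raddf_sum /= => /msupp_sum_le /flatten_mapP[m' _].
rewrite comp_mpolyZ monomial_map_mon => /msuppZ_le; rewrite msuppX inE => /eqP ->.
rewrite subr0; apply: (big_ind (fun x => (D %| weight x)%Z)) => [|x y Dx Dy|i _].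
- by rewrite /weight big1 ?dvdz0 // => j _; rewrite mnm0E mul0r.
- by rewrite weightD; exact: rpredD.
- elim: (m' i) => [|e IHe].
    by rewrite mulm0n /weight big1 ?dvdz0 // => j _; rewrite mnm0E mul0r.
  by rewrite mulmS weightD; exact: rpredD.
Qed.

(** Two terms sharing a monomial have the same class, so coefficientwise the
    terms selected by P are either all or none of the nonzero ones. *)
Lemma pure_split (I : finType) (T : I -> R) (c : I -> int) (P : pred I) :
    (forall i, pure (c i) (T i)) ->
    (forall i j, (D %| c i - c j)%Z -> P i = P j) ->
    \sum_i T i = 0 -> \sum_(i | P i) T i = 0.
Proof.
move=> Tc Pc T0; apply/mpolyP => m; rewrite mcoeff0 raddf_sum /=.
have same i j : (T i)@_m != 0 -> (T j)@_m != 0 -> P i = P j.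
  rewrite -!mcoeff_msupp => /Tc Ti /Tc Tj; apply: Pc.
  by have := rpredB Tj Ti; congr (_ %| _)%Z; lia.
case: (pickP (fun i => P i && ((T i)@_m != 0))) => [i /andP[Pi Ti]|no].
  have := congr1 (mcoeff m) T0; rewrite mcoeff0 raddf_sum /= (bigID P) /=.
  rewrite [X in _ + X]big1 ?addr0 // => j Pj; apply/eqP; apply: contraNT Pj => Tj.
  by rewrite (same j i).
by apply: big1 => i Pi; apply/eqP; have := no i; rewrite Pi => /negbFE.
Qed.

(** After clearing denominators, c i * y ^+ i becomes pure of class
    i * w t1. As D = w t1 * d with D nonzero, this class determines i modulo d,
    so a vanishing sum splits according to i modulo d. *)
Lemma weight_relation_split (d : nat) (t1 t2 : 'I_n.+1) s (c : nat -> {fraction R}) :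
    D != 0 -> w t1 * d%:Z = D -> w t2 = 0 ->
    (forall i, exists U V : R,
       [/\ pure 0 U, pure 0 V, V != 0 & c i = tofrac U / tofrac V]) ->
    let y := tofrac ('X_t1 : R) / tofrac ('X_t2 : R) in
    \sum_(i < s) c i * y ^+ i = 0 ->
    forall r, \sum_(i < s | (i %% d == r)%N) c i * y ^+ i = 0.
Proof.
move=> D_neq0 wt1 wt2 cUV y rel r.
have wt1_neq0 : w t1 != 0 by apply: contraNneq D_neq0 => wt10; rewrite -wt1 wt10 mul0r.
have x2_neq0 : tofrac ('X_t2 : R) != 0 by rewrite tofrac_eq0 -msupp_eq0 msuppX.
have /fin_all_exists[U /fin_all_exists[V UV]] : forall i : 'I_s, exists U V : R,
   [/\ pure 0 U, pure 0 V, V != 0 & c i = tofrac U / tofrac V] by move=> i; exact: cUV.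
pose Q := \prod_i V i.
pose T (i : 'I_s) : R :=
  U i * (\prod_(j | j != i) V j) * ('X_t1 ^+ i * 'X_t2 ^+ (s - i)).
have Q_neq0 : tofrac Q != 0.
  by rewrite tofrac_eq0; apply/prodf_neq0 => i _; have [] := UV i.
have TE i : tofrac (T i) = c i * y ^+ i * (tofrac Q * tofrac ('X_t2 : R) ^+ s).
  have [_ _ Vi ->] := UV i.
  have {}Vi : tofrac (V i) != 0 by rewrite tofrac_eq0.
  rewrite /T /Q [\prod_i V i](bigD1 i) //= !tofracM !tofracXn /y expr_div_n.
  have -> : tofrac ('X_t2 : R) ^+ s = tofrac 'X_t2 ^+ (s - i) * tofrac 'X_t2 ^+ i.
    by rewrite -exprD subnK // ltnW.
  by rewrite (clear_denominators _ _ _ _ Vi (expf_neq0 i x2_neq0)).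
have sumE (P : pred 'I_s) : tofrac (\sum_(i | P i) T i) =
    (\sum_(i | P i) c i * y ^+ i) * (tofrac Q * tofrac ('X_t2 : R) ^+ s).
  by rewrite rmorph_sum big_distrl; apply: eq_bigr => i _; exact: TE.
have Tpure (i : 'I_s) : pure (i%:Z * w t1) (T i).
  have [U0 V0 _ _] := UV i; rewrite -[_ * _]add0r /T; apply: pureM.
    by rewrite -[0]addr0; apply: pureM => //; apply: pure_prod => j; have [] := UV j.
  rewrite -[_ * _]addr0 -[X in _ + X](mulr0 (s - i)%:Z) -wt2 -!weightU.
  by apply: pureM; apply: pureXn; exact: pureX.
suff : \sum_(i < s | (i %% d == r)%N) T i = 0.
  move/(congr1 (@tofrac R)); rewrite sumE tofrac0 => /eqP.
  by rewrite !mulf_eq0 (negPf Q_neq0) expf_eq0 (negPf x2_neq0) andbF !orbF => /eqP.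
apply: (pure_split Tpure).
  move=> i j; rewrite -mulrBl -wt1 [w t1 * _]mulrC dvdz_mul2r // => dij.
  suff -> : (i %% d = j %% d)%N by [].
  by apply/eqP; rewrite -eqz_nat -!modz_nat; rewrite -eqz_mod_dvd in dij.
by apply/eqP; rewrite -tofrac_eq0 (sumE predT) rel mul0r.
Qed.
End WeightGrading.

Section Degree.
Variables (k : fieldType) (n d m : nat) (a : 'I_n.+1 -> 'X_{1..n.+1}).
Hypothesis mdeg_a : forall i, mdeg (a i) = d.
Local Notation R := {mpoly k[n.+1]}.
Local Notation f := (monomial_map k a).
Local Notation A := (fun i j : 'I_n.+1 => a i j).

(** With the weights of critical_weights, every component of f has weight 0
    modulo det A, so the pullback field lies in class 0, whereas the class of
    y = 'X_t1 / 'X_t2 has order d. Relations on the powers of y over the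
    pullback field therefore split modulo d. *)
Lemma map_degree_dvd (S1 S2 : {set 'I_n.+1}) :
    \det (\matrix_(i < n.+1, j < n.+1) (a i j)%:Z) != 0 :> int ->
    S1 != set0 -> S2 != set0 -> [disjoint S1 & S2] ->
    #|cols A S1| = #|S1| -> #|cols A S2| = #|S2| ->
  map_degree f m -> (d %| m)%N.
Proof.
move=> detA S1n0 S2n0 dis crit1 crit2 degm.
have rowsum i : (\sum_j A i j = d)%N by rewrite -mdegE.
have [w [t1 [t2 [wA wt1 wt2]]]] :=
  critical_weights detA rowsum S1n0 S2n0 dis crit1 crit2.
pose phiL : {rmorphism R -> {fraction R}} := @tofrac R.
pose phiK : {rmorphism R -> {fraction R}} := (@tofrac R \o comp_mpoly f).
have KE z : pullback_field f z <-> homogeneous_ratio phiK z by [].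
have LE z : function_field z <-> homogeneous_ratio phiL z by [].
pose y := tofrac ('X_t1 : R) / tofrac ('X_t2 : R).
apply: (@extension_degree_dvd _ (homogeneous_ratio phiK) (homogeneous_ratio phiL) m d y).
- exact: homogeneous_ratio1.
- exact: homogeneous_ratioB.
- exact: homogeneous_ratioV.
- exact: homogeneous_ratio1.
- exact: homogeneous_ratioB.
- exact: homogeneous_ratioV.
- move=> z [e [u [v [ue ve v0 ->]]]].
  have [vf|vf] := eqVneq (v \mPo f) 0.
    by rewrite /= vf tofrac0 invr0 mulr0; exact: homogeneous_ratio0.
  by exists (e * d)%N, (u \mPo f), (v \mPo f); split=> //; exact: monomial_map_homog.
- exact: degm.
- exists 1%N, 'X_t1, 'X_t2; split=> //; rewrite ?dhomogX; try exact/eqP/mdeg1.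
  by rewrite -msupp_eq0 msuppX.
- by rewrite mulf_eq0 invr_eq0 !tofrac_eq0 -!msupp_eq0 !msuppX.
- move=> s c cK rel r; apply: (weight_relation_split detA wt1 wt2) rel r => i.
  have [e [u [v [ue ve v0 ->]]]] := cK i.
  have pure_f (x : R) : pure w (\det (\matrix_(i, j) (a i j)%:Z)) 0 (x \mPo f).
    exact: pure_monomial_map.
  have [vf|vf] := eqVneq (v \mPo f) 0.
    exists 0, 1; rewrite oner_neq0 tofrac0 mul0r.
    split=> //; last by rewrite /= vf tofrac0 invr0 mulr0.
      by move=> x; rewrite msupp0.
    exact: pure1.
  by exists (u \mPo f), (v \mPo f); split.
Qed.

End Degree.

(** * Dimension of the indeterminacy locus *)

Unset Implicit Arguments.

Theorem theorem1 (k : fieldType) (n d : nat) (hn : (1 <= n)%N) (hd : (1 <= d)%N)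
    (a : 'I_n.+1 -> 'X_{1..n.+1})
    (hdeg : forall i : 'I_n.+1, mdeg (a i) = d)
    (hcoprime : forall j : 'I_n.+1, exists i : 'I_n.+1, a i j = 0%N)
    (hdom : dominant (monomial_map k a))
    (m : nat) (hm : map_degree (monomial_map k a) m)
    (hndiv : ~~ (d %| m)%N) :
  dim_at_least (indeterminacy_locus (monomial_map k a)) ((n%:R - 2%:R) / 2%:R).
Proof.
have detA := dominant_det_neq0 hdeg hd hdom.
have [||S|S1 S2 S1n0 S2n0 dis crit1 crit2|J cardJ hit] :=
  @small_transversal _ _ (fun i j : 'I_n.+1 => a i j).
- by rewrite card_ord.
- by [].
- exact: det_hall.
- move/negP: hndiv; apply.
  exact: (map_degree_dvd hdeg detA S1n0 S2n0 dis crit1 crit2 hm).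
rewrite card_ord in cardJ.
(* J is proper: 2 * #|J| <= n + 2 < 2 * (n + 1) because n >= 1. *)
have JT : J != setT.
  apply/eqP => JT; move: cardJ; rewrite JT cardsT card_ord; lia.
apply: (coord_subspace_dim JT (indeterminacy_coord_subspace hit)).
have cardJn : (#|J| <= n)%N by lia.
rewrite natrB // ler_pdivrMr ?ltr0n // mulrBl lerBlDr addrAC.
rewrite lerBrDr -!natrM -!natrD ler_nat.
by move: cardJ; rewrite -muln2; move: #|J| => c; lia.
Qed.
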